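(* For $n\ge 1$, the number of $\pi\in S_n$ avoiding both arrow patterns $(12;1\to 2)$ and $(1;1\to 1)$ equals the $n$-th 2-associated Bell number, i.e. the number of set partitions of $[n]$ with no singleton blocks.
   Context: Standard cycle form of $\sigma\in S_n$: product of disjoint cycles (fixed points included), each cycle starting with its largest element, cycles listed in increasing order of largest elements. The fundamental bijection $\theta:S_n\to S_n$ erases the parentheses of the standard cycle form to give a one-line permutation. For $\pi\in S_n$, $\hat\pi=\theta^{-1}(\pi)$. An arrow pattern $(\nu;H)$ of size $k$: a string $\nu=a_1\dots a_m$ of positive integers and a set $H$ of arrows $b\to c$, with all integers appearing forming $[k]$. $\pi\in S_n$ contains $(\nu;H)$ if there is $X=\{x_1<\dots<x_k\}\subseteq[n]$ with positions $t_1<\dots<t_m$ such that $\pi_{t_1}\cdots\pi_{t_m}=x_{a_1}\cdots x_{a_m}$ and $\hat\pi(x_b)=x_c$ for every arrow $b\to c\in H$; otherwise it avoids it. In particular $\pi$ avoids $(1;1\to1)$ iff $\hat\pi$ has no fixed points. *)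

(* Defs.v *)
From mathcomp Require Import all_boot fingroup perm.

Set Implicit Arguments.
Unset Strict Implicit.
Unset Printing Implicit Defensive.

(* [n] is modelled by 'I_n = {0, ..., n-1}, and a permutation p : 'S_n in
   one-line notation is p 0, p 1, ..., p (n-1). *)

Section FundamentalBijection.

Variable n : nat.
Implicit Types (s : 'S_n) (x y : 'I_n).

Definition cycle_leader s : pred 'I_n :=
  fun x => [forall y in porbit s x, y <= x].

(* enum 'I_n is increasing, and orbit s x = [:: x; s x; s (s x); ...]. *)
Definition std_cycle_form s : seq (seq 'I_n) :=
  [seq orbit s x | x <- enum 'I_n & cycle_leader s x].

Definition theta_word s : seq 'I_n := flatten (std_cycle_form s).

Lemma mem_orbit_porbit s x y : (y \in orbit s x) = (y \in porbit s x).
Proof.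
rewrite -fconnect_orbit; apply/idP/idP => [/iter_findex <-|/porbitP[i ->]].
  by rewrite -permX mem_porbit.
by rewrite permX fconnect_iter.
Qed.

Lemma mem_theta_word s y : y \in theta_word s.
Proof.
pose x := [arg max_(i > y in porbit s y) val i].
have [xy xmax] : x \in porbit s y /\ forall z, z \in porbit s y -> z <= x.
  by rewrite /x; case: arg_maxnP => [|i]; rewrite ?porbit_id.
have Exy : porbit s x = porbit s y by apply/eqP; rewrite eq_porbit_mem.
apply/flattenP; exists (orbit s x); last first.
  by rewrite mem_orbit_porbit Exy porbit_id.
apply/map_f; rewrite mem_filter mem_enum andbT.
by apply/forall_inP => z; rewrite Exy; apply: xmax.
Qed.

Lemma theta_word_uniq s : uniq (theta_word s).
Proof.
rewrite /theta_word /std_cycle_form.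
have : all (cycle_leader s) (filter (cycle_leader s) (enum 'I_n)).
  exact: filter_all.
have : uniq (filter (cycle_leader s) (enum 'I_n)).
  by rewrite filter_uniq ?enum_uniq.
elim: (filter _ _) => //= x r IHr /andP[xr ur] /andP[Lx Lr].
rewrite cat_uniq orbit_uniq IHr // andbT /=.
apply/hasPn => z /flattenP[_ /mapP[y yr ->] zy]; apply/negP => zx.
have Ly : cycle_leader s y by apply: (allP Lr).
move: zx zy; rewrite !mem_orbit_porbit => zx zy.
have Exy : porbit s x = porbit s y.
  by move: zx zy; rewrite -!eq_porbit_mem => /eqP <- /eqP.
suff Dxy : x = y by rewrite Dxy yr in xr.
apply/val_inj/eqP; rewrite eqn_leq.
rewrite (forall_inP Ly) ?(forall_inP Lx) //; first by rewrite Exy porbit_id.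
by rewrite -Exy porbit_id.
Qed.

Lemma size_theta_word s : size (theta_word s) == n.
Proof.
rewrite -(card_uniqP (theta_word_uniq s)) -[X in _ == X]card_ord.
by apply/eqP/eq_card => x; rewrite mem_theta_word.
Qed.

Lemma theta_tnth_inj s : injective (tnth (Tuple (size_theta_word s))).
Proof. by apply/tuple_uniqP; apply: theta_word_uniq. Qed.

Definition theta s : 'S_n := perm (@theta_tnth_inj s).

(* Each cycle starts with its largest element, which exceeds everything that
   precedes it; hence the word determines where the cycles start. *)
Let wf_cycle (c : seq 'I_n) := if c is x :: r then all (fun y : 'I_n => y < x) r else false.
Let below (c d : seq 'I_n) :=
  match c, d with x :: _, y :: _ => x < y | _, _ => false end.

Lemma wf_flatten_inj (ss tt : seq (seq 'I_n)) :
  all wf_cycle ss -> all wf_cycle tt -> sorted below ss -> sorted below tt ->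
  flatten ss = flatten tt -> ss = tt.
Proof.
elim: ss tt => [|[|x r] ss IH] [|[|y q] tt] //= /andP[xr wss] /andP[yq wtt].
move=> pss ptt [Exy E]; rewrite -{y}Exy in yq ptt *.
suff [Erq Est] : r = q /\ flatten ss = flatten tt.
  by rewrite Erq (IH tt) // ?(path_sorted pss) ?(path_sorted ptt).
have {pss} : if flatten ss is z :: _ then x < z else true.
  by case: ss wss pss {IH E} => [|[|z u] ss] //= _ /andP[].
have {ptt} : if flatten tt is z :: _ then x < z else true.
  by case: tt wtt ptt {E} => [|[|z u] tt] //= _ /andP[].
move: (flatten ss) (flatten tt) E => u v E hv hu.
elim: r q xr yq E => [|a r IHr] [|b q] //=.
- by move=> _ /andP[bx _] E; rewrite E ltnNge ltnW in hu.
- by move=> /andP[ax _] _ E; rewrite -E ltnNge ltnW in hv.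
by move=> /andP[_ hr] /andP[_ hq] [-> /(IHr _ hr hq) [-> ->]].
Qed.

Lemma std_cycle_form_wf s : all wf_cycle (std_cycle_form s).
Proof.
apply/allP => _ /mapP[x + ->]; rewrite mem_filter => /andP[/forall_inP Lx _].
have := orbit_uniq s x; have := mem_orbit_porbit s x.
rewrite /orbit -orderSpred /= => Ex /andP[xr _].
apply/allP => y yr; rewrite /= ltn_neqAle Lx -?Ex ?inE ?yr ?orbT // andbT.
by apply: contra xr => /eqP/val_inj Eyx; rewrite -{1}Eyx.
Qed.

Lemma std_cycle_form_sorted s : sorted below (std_cycle_form s).
Proof.
have orbE z : exists r, orbit s z = z :: r.
  by rewrite /orbit -orderSpred; eexists.
have E : relpre (orbit s) below =2 relpre val ltn.
  by move=> x y; rewrite /relpre /=; have [[r ->] [q ->]] := (orbE x, orbE y).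
rewrite sorted_map (eq_sorted E).
apply: sorted_filter; first by move=> y x z; apply: ltn_trans.
by rewrite -sorted_map val_enum_ord iota_ltn_sorted.
Qed.

Lemma theta_inj : injective theta.
Proof.
move=> s t Est.
have Ew : theta_word s = theta_word t.
  suff: Tuple (size_theta_word s) = Tuple (size_theta_word t) by case.
  by apply: eq_from_tnth => i; have := congr1 (fun p : 'S_n => p i) Est;
    rewrite !permE.
have Ef : std_cycle_form s = std_cycle_form t.
  by apply: wf_flatten_inj Ew; rewrite ?std_cycle_form_wf ?std_cycle_form_sorted.
have step (u : 'S_n) c y : c \in std_cycle_form u -> y \in c -> u y = next c y.
  move=> /mapP[x _ ->] yx; apply/eqP.
  exact: next_cycle (cycle_orbit (@perm_inj _ u) x) yx.
apply/permP => y; have /flattenP[c cs yc] := mem_theta_word s y.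
by rewrite (step s c) // (step t c) // -Ef.
Qed.

Definition hat : 'S_n -> 'S_n := invF theta_inj.

End FundamentalBijection.

(* A pattern (nu; H) of size k; the letter i of [k] is the ordinal i-1. *)
Record arrow_pattern (k : nat) := ArrowPattern {
  ap_word : seq 'I_k;
  ap_arrows : {set 'I_k * 'I_k};
  ap_cover : forall i : 'I_k,
    (i \in ap_word) || [exists e in ap_arrows, (i == e.1) || (i == e.2)]
}.

(* x lists x_1 < ... < x_k and t lists the positions t_1 < ... < t_m. *)
Definition contains n k (p : 'S_n) (A : arrow_pattern k) : bool :=
  [exists x : k.-tuple 'I_n, exists t : (size (ap_word A)).-tuple 'I_n,
    [&& sorted ltn (map val x),
        sorted ltn (map val t),
        [seq p i | i <- t] == [seq tnth x a | a <- ap_word A]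
      & [forall e in ap_arrows A, hat p (tnth x e.1) == tnth x e.2]]].

Definition avoids n k (p : 'S_n) (A : arrow_pattern k) : bool :=
  ~~ contains p A.

Lemma pat_12_cover (i : 'I_2) :
  (i \in [:: ord0; ord_max]) ||
  [exists e in [set (ord0 : 'I_2, ord_max : 'I_2)], (i == e.1) || (i == e.2)].
Proof. by apply/orP; left; rewrite !inE -!val_eqE; case: i => [[|[|//]] ?]. Qed.

(* (12; 1 -> 2) *)
Definition pat_12 : arrow_pattern 2 := ArrowPattern pat_12_cover.

Lemma pat_fix_cover (i : 'I_1) :
  (i \in [:: ord0]) ||
  [exists e in [set (ord0 : 'I_1, ord0 : 'I_1)], (i == e.1) || (i == e.2)].
Proof. by apply/orP; left; rewrite inE (ord1 i). Qed.

(* (1; 1 -> 1) *)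
Definition pat_fix : arrow_pattern 1 := ArrowPattern pat_fix_cover.

Definition associated_bell2 (n : nat) : nat :=
  #|[set P : {set {set 'I_n}} |
      partition P [set: 'I_n] && [forall B in P, #|B| != 1]]|.

(* Main.v *)
(** Put s = hat p, so that p lists the cycles of s one after the other.  An
occurrence of (12; 1 -> 2) is a point x with x < s x preceding s x in p; unless
x closes its cycle, in which case s x is the earlier-listed cycle maximum, s x
comes immediately after x.  Hence p avoids the pattern iff every cycle of s,
read from its maximum, is decreasing.  Such an s is determined by its partition
into cycles, any partition arises, and fixed points are the singleton blocks. *)

Require Import Defs.
From mathcomp Require Import all_boot fingroup perm.

Set Implicit Arguments.
Unset Strict Implicit.
Unset Printing Implicit Defensive.

Section CyclePartition.

Variable T : finType.
Implicit Types (s : {perm T}) (x : T).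

(** The cycles are the fibres of [porbit s], so the partition property follows from
    [preim_partitionP]. *)
Lemma porbitsE s : porbits s = preim_partition (porbit s) [set: T].
Proof.
have E x : [set y in [set: T] | porbit s x == porbit s y] = porbit s x.
  by apply/setP => y; rewrite !inE eq_sym eq_porbit_mem.
apply/setP => B; apply/imsetP/imsetP => -[x _ ->]; exists x; rewrite ?E //.
Qed.

Lemma partition_porbits s : partition (porbits s) [set: T].
Proof. by rewrite porbitsE preim_partitionP. Qed.

Lemma pblock_porbits s x : pblock (porbits s) x = porbit s x.
Proof.
apply: def_pblock (partition_trivIset (partition_porbits s)) _ (porbit_id s x).
exact: imset_f.
Qed.

Lemma card_porbit_eq1 s x : (#|porbit s x| == 1) = (s x == x).
Proof.
apply/idP/eqP => [/cards1P[y E]|sx].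
  have : x \in porbit s x by apply: porbit_id.
  have : s x \in porbit s x by rewrite -[s x]/((s ^+ 1)%g x) mem_porbit.
  by rewrite E !inE => /eqP -> /eqP.
apply/cards1P; exists x; apply/setP => y; rewrite inE.
apply/porbitP/eqP => [[i ->]|->]; last by exists 0; rewrite perm1.
by rewrite permX; elim: i => //= i ->.
Qed.

Lemma porbits_no_singleton s :
  [forall B in porbits s, #|B| != 1] = ~~ [exists x, s x == x].
Proof.
rewrite negb_exists; apply/forall_inP/forallP => [h x|h _ /imsetP[x _ ->]].
  by rewrite -card_porbit_eq1 h ?imset_f.
by rewrite card_porbit_eq1.
Qed.

End CyclePartition.

Section DecreasingCycles.

Variable n : nat.
Implicit Types (s : 'S_n) (x y : 'I_n) (B : {set 'I_n}) (P : {set {set 'I_n}}).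

Lemma gtn_ord_trans : transitive (fun y z : 'I_n => z < y).
Proof. by move=> y x z xy yz; apply: ltn_trans yz xy. Qed.

(** Only adjacent entries of the orbit are compared, so the return from the last entry to the leader
    is exempt. *)
Definition decreasing_cycles s :=
  [forall x, cycle_leader s x ==> sorted (fun y z : 'I_n => z < y) (orbit s x)].

(** As [enum B] is increasing, its reversal is the only decreasing word on a block, hence the only
    candidate for its cycle. *)
Definition descending B : seq 'I_n := rev (enum B).

Lemma mem_descending B x : (x \in descending B) = (x \in B).
Proof. by rewrite mem_rev mem_enum. Qed.

Lemma descending_uniq B : uniq (descending B).
Proof. by rewrite rev_uniq enum_uniq. Qed.

Lemma descending_sorted B : sorted (fun y z : 'I_n => z < y) (descending B).
Proof.
rewrite rev_sorted {1}/enum_mem.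
apply: sorted_filter; first by move=> y x z; apply: ltn_trans.
by have := iota_ltn_sorted 0 n; rewrite -val_enum_ord sorted_map enumT.
Qed.

Lemma hat_theta s : hat (theta s) = s.
Proof. exact: invF_f. Qed.

Lemma index_theta s x : val (((theta s)^-1)%g x) = index x (theta_word s).
Proof.
set i := _ x; have <- : theta s i = x by rewrite /i permKV.
rewrite permE (tnth_nth x) /= index_uniq ?theta_word_uniq //.
by rewrite (eqP (size_theta_word s)).
Qed.

(** The arrow forces the larger value to be [s x], so an occurrence is determined by its smaller
    value [x]; [index_theta] turns positions into indices in the word. *)
Lemma contains_pat_12 s : contains (theta s) pat_12 =
  [exists x : 'I_n, (x < s x) &&
     (index x (theta_word s) < index (s x) (theta_word s))].
Proof.
apply/idP/existsP.
  case/existsP=> x /existsP[t /and4P[]].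
  rewrite hat_theta /= => sx st /eqP E /forall_inP/(_ (ord0, ord_max)).
  rewrite inE eqxx => /(_ isT)/eqP /= sE.
  exists (tnth x ord0); rewrite sE -!index_theta.
  move: sx st E {sE}; case: x => [[|x0 [|x1 [|]]] //= sz].
  case: t => [[|t0 [|t1 [|]]] //= sz'].
  rewrite !andbT !(tnth_nth x0) /= => -> lt [<- <-].
  by rewrite !permK.
case=> x /andP[lx li].
apply/existsP; exists [tuple x; s x].
apply/existsP; exists [tuple (((theta s)^-1)%g x); (((theta s)^-1)%g (s x))].
apply/and4P; split; rewrite /= ?andbT //.
- by have := li; rewrite -!index_theta.
- by rewrite !permKV !(tnth_nth x).
apply/forall_inP => e; rewrite inE => /eqP ->.
by rewrite hat_theta !(tnth_nth x).
Qed.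

Lemma contains_pat_fix s : contains (theta s) pat_fix = [exists x, s x == x].
Proof.
apply/idP/existsP.
  case/existsP=> x /existsP[t /and4P[_ _ _]].
  rewrite hat_theta => /forall_inP/(_ (ord0, ord0)).
  by rewrite inE eqxx => /(_ isT) /= sE; exists (tnth x ord0).
case=> x sx.
apply/existsP; exists [tuple x].
apply/existsP; exists [tuple (((theta s)^-1)%g x)].
apply/and4P; split; rewrite /= ?andbT //.
  by rewrite !permKV !(tnth_nth x).
apply/forall_inP => e; rewrite inE => /eqP ->.
by rewrite hat_theta !(tnth_nth x).
Qed.

Lemma cycle_leader_exists s y : exists2 x, cycle_leader s x & y \in orbit s x.
Proof.
have /flattenP[_ /mapP[x + ->] yx] := mem_theta_word s y.
by rewrite mem_filter => /andP[Lx _]; exists x.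
Qed.

(** The shift [k] is the total length of the cycles listed before that of [x]; it cancels when two
    entries of one cycle are compared. *)
Lemma index_theta_word s x : cycle_leader s x ->
  exists k, {in orbit s x, forall y,
    index y (theta_word s) = k + index y (orbit s x)}.
Proof.
move=> Lx; have: orbit s x \in std_cycle_form s.
  by apply: map_f; rewrite mem_filter Lx mem_enum.
have := theta_word_uniq s; rewrite /theta_word.
move=> + xs; case/splitPr: xs => u v.
rewrite flatten_cat /= !cat_uniq => /and3P[_ /hasPn h _].
exists (size (flatten u)) => y yx; rewrite !index_cat yx ifN //.
by apply: h; rewrite mem_cat yx.
Qed.

Lemma avoids_pat_12 s : avoids (theta s) pat_12 = decreasing_cycles s.
Proof.
rewrite /avoids contains_pat_12; apply/idP/forall_inP => [|dec].
  move=> /existsPn av x Lx.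
  apply/(sortedP x) => i; rewrite size_orbit => lti.
  have lti' := ltnW lti; have ux := orbit_uniq s x.
  have nE j : j < fingraph.order s x -> nth x (orbit s x) j = iter j s x.
    by move=> ltj; rewrite /orbit nth_traject.
  have [k kE] := index_theta_word Lx.
  set y := nth x _ i; have sE : nth x (orbit s x) i.+1 = s y.
    by rewrite /y !nE.
  have yx : y \in orbit s x by rewrite mem_nth ?size_orbit.
  have sx : s y \in orbit s x by rewrite -sE mem_nth ?size_orbit.
  (* The indices of [y] and [s y] in the orbit are [i] and [i.+1], so avoidance yields [s y <= y];
     equality would repeat an entry of a duplicate-free orbit. *)
  have := av y; rewrite !kE // ltn_add2l -sE.
  rewrite !index_uniq ?size_orbit // ltnSn andbT -leqNgt leq_eqVlt.
  case/orP=> // /eqP/val_inj E.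
  have := nth_uniq x _ _ ux; rewrite size_orbit => /(_ _ _ lti lti').
  by rewrite -/y E eqxx (gtn_eqF (ltnSn i)).
apply/existsPn => y; rewrite negb_and -implybE; apply/implyP => lty.
(* Both [y] and [s y] lie in one cycle; if [y] came first, the decreasing order would give
   [s y < y]. *)
have [x Lx yx] := cycle_leader_exists s y.
have [k kE] := index_theta_word Lx.
have sx : s y \in orbit s x by apply: mem_orbit.
rewrite !kE // ltn_add2l; apply/negP => lt.
have := sorted_ltn_index gtn_ord_trans (dec x Lx) _ _ yx sx lt.
by rewrite ltnNge ltnW.
Qed.

(** A strictly decreasing word is determined by its set of entries. The right-hand side thus depends
    on [s] only through its cycle partition, whence the injectivity below. *)
Lemma decreasing_cyclesE s y : decreasing_cycles s ->
  s y = next (descending (porbit s y)) y.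
Proof.
move=> /forall_inP dec; have [x Lx yx] := cycle_leader_exists s y.
have Exy : porbit s y = porbit s x.
  by apply/eqP; rewrite eq_porbit_mem -mem_orbit_porbit.
have <- : orbit s x = descending (porbit s y).
  apply: irr_sorted_eq gtn_ord_trans _ _ _ (dec x Lx) (descending_sorted _) _.
    by move=> a; apply: ltnn.
  by move=> z; rewrite mem_orbit_porbit mem_descending Exy.
by rewrite (nextE (cycle_orbit (@perm_inj _ s) x)).
Qed.

Lemma porbits_decreasing_inj :
  {in [pred s | decreasing_cycles s] &, injective (@porbits 'I_n)}.
Proof.
move=> s t ds dt E; apply/permP => y.
by rewrite !decreasing_cyclesE // -!pblock_porbits E.
Qed.

Lemma porbits_decreasing_surj P : partition P [set: 'I_n] ->
  exists2 s, decreasing_cycles s & porbits s = P.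
Proof.
move=> PP; have tP := partition_trivIset PP.
(* Each block becomes one cycle: [next] goes down to the next smaller element and wraps from the
   minimum to the maximum. *)
pose f x := next (descending (pblock P x)) x.
have xP x : x \in pblock P x by rewrite mem_pblock (cover_partition PP) inE.
have fP x : pblock P (f x) = pblock P x.
  by apply/same_pblock => //; rewrite -mem_descending mem_next mem_descending.
have f_inj : injective f.
  (* Since [f] preserves blocks, [prev] in the same list undoes it. *)
  apply: (can_inj (g := fun x => prev (descending (pblock P x)) x)) => x.
  by rewrite fP prev_next ?descending_uniq.
pose s := perm f_inj.
have cyc x : fcycle s (descending (pblock P x)).
  apply: cycle_from_next (descending_uniq _) _ => y.
  by rewrite mem_descending /= permE /f => yx; rewrite (same_pblock tP yx).
have sP x : porbit s x = pblock P x.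
  apply/setP => y; rewrite -mem_orbit_porbit -fconnect_orbit.
  by rewrite (fconnect_cycle (cyc x)) mem_descending.
exists s.
  apply/forall_inP => x Lx.
  have xD : x \in descending (pblock P x) by rewrite mem_descending.
  (* The orbit is the descending word rotated to start at [x]. A leader is the block maximum, which
     is the head [z], so the rotation is trivial. *)
  rewrite (orbitE (cyc x) (descending_uniq _) xD).
  have := descending_sorted (pblock P x).
  move: xD (mem_descending (pblock P x)).
  case E: descending => [//|z r] xD mD srt.
  have zP : z \in pblock P x by rewrite -mD mem_head.
  suff -> : x = z by rewrite /= eqxx rot0.
  apply/val_inj/eqP; rewrite eqn_leq (forall_inP Lx) ?sP // andbT.
  move: xD; rewrite inE => /predU1P[-> //|xr]; apply: ltnW.
  move: srt => /= /(order_path_min gtn_ord_trans).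
  by move/allP; apply.
apply/setP => B; apply/imsetP/idP => [[x _ ->]|BP].
  by rewrite sP pblock_mem // (cover_partition PP) inE.
have /set0Pn[x xB] := partition_neq0 PP BP.
by exists x; rewrite // sP (def_pblock tP BP xB).
Qed.

End DecreasingCycles.

Theorem theorem6p1 (n : nat) (hn : 1 <= n) :
  #|[set p : 'S_n | avoids p pat_12 && avoids p pat_fix]| = associated_bell2 n.
Proof.
(* By injectivity of [theta], the permutations [s] with [theta s] avoiding both patterns are counted
   instead. *)
rewrite -(card_preimset _ (@theta_inj n)).
pose D := [set s : 'S_n | decreasing_cycles s && ~~ [exists x, s x == x]].
have -> : @theta n @^-1: [set p | avoids p pat_12 && avoids p pat_fix] = D.
  by apply/setP => s; rewrite !inE avoids_pat_12 /avoids contains_pat_fix.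
(* It remains to identify the image of [D] under [porbits] with the singleton-free partitions. *)
rewrite -(card_in_imset (f := @porbits _)); last first.
  move=> s t; rewrite !inE => /andP[ds _] /andP[dt _].
  exact: porbits_decreasing_inj.
apply: eq_card => P; rewrite !inE; apply/imsetP/andP => [[s]|[PP fP]].
  by rewrite inE -porbits_no_singleton => /andP[_ h] ->; rewrite partition_porbits.
have [s ds E] := porbits_decreasing_surj PP.
by exists s; rewrite // inE ds -porbits_no_singleton E.
Qed.
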